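(* Let $f$ be a symmetric nontrivial tradeoff function and let $N$ be a real-valued random variable such that $T(N,N+1)\geq f$. Then for every integer $t>0$, $$\sup_{a\in\mathbb{R}}P\left(-t/2<N-a\leq t/2\right)\leq\begin{cases}1-2f^{\circ k}(c_f)&\text{if } t=2k+1,\\ 1-2f^{\circ k}(1/2)&\text{if } t=2k,\end{cases}$$ where $k$ is a non-negative integer.
   Context: For probability distributions $P,Q$ on a common measurable space, the tradeoff function $T(P,Q):[0,1]\to[0,1]$ is $T(P,Q)(\alpha)=\inf\{1-\mathbb{E}_Q(\phi)\mid \mathbb{E}_P(\phi)\leq 1-\alpha\}$, the infimum over measurable tests $\phi$ with values in $[0,1]$. For random variables $X,Y$, $T(X,Y)$ denotes the tradeoff function of their laws. A function $f:[0,1]\to[0,1]$ is a tradeoff function if $f=T(P,Q)$ for some $P,Q$; equivalently, $f$ is convex, continuous, non-decreasing, and $f(x)\leq x$ for all $x\in[0,1]$. It is nontrivial if $f(\alpha)<\alpha$ for some $\alpha\in(0,1)$, and symmetric if $f=T(P,Q)$ implies $f=T(Q,P)$. Inequalities between functions are pointwise. For a symmetric tradeoff function $f$, $c_f$ is the unique value with $f(1-c_f)=c_f$. $f^{\circ k}=f\circ\cdots\circ f$ ($k$ times), with $f^{\circ 0}$ the identity. *)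

(* Defs.v *)
From HB Require Import structures.
From mathcomp Require Import all_boot all_order all_algebra.
From mathcomp Require Import all_classical all_reals all_analysis.
From mathcomp Require Import measurable_realfun.

Set Implicit Arguments.
Unset Strict Implicit.
Unset Printing Implicit Defensive.

Import Order.TTheory GRing.Theory Num.Theory.
Import numFieldNormedType.Exports.
Local Open Scope classical_set_scope.
Local Open Scope ring_scope.

(* Functions on [0, 1] are represented by functions R -> R, whose values
   outside [0, 1] are irrelevant: every condition below on such a function is
   restricted to arguments in [0, 1]. *)

Definition is_test (R : realType) d (T : measurableType d) (phi : T -> R) :=
  measurable_fun setT phi /\ (forall x, 0 <= phi x <= 1).

Definition tradeoff (R : realType) d (T : measurableType d)
    (P Q : probability T R) (alpha : R) : \bar R :=
  ereal_inf [set (1 - 'E_Q[phi])%E | phi in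
    [set phi : T -> R | is_test phi /\ ('E_P[phi] <= (1 - alpha)%:E)%E]].

Definition tradeoff_rv (R : realType) d (Omega : measurableType d)
    (P : probability Omega R) (X Y : {RV P >-> R}) : R -> \bar R :=
  tradeoff (distribution P X) (distribution P Y).

Definition equals_tradeoff (R : realType) (f : R -> R)
    d (T : measurableType d) (P Q : probability T R) :=
  forall alpha : R, 0 <= alpha <= 1 -> (f alpha)%:E = tradeoff P Q alpha.

Definition tradeoff_function (R : realType) (f : R -> R) :=
  exists (d : measure_display) (T : measurableType d) (P Q : probability T R),
    equals_tradeoff f P Q.

Definition nontrivial_tradeoff (R : realType) (f : R -> R) :=
  exists alpha : R, 0 < alpha < 1 /\ f alpha < alpha.

Definition symmetric_tradeoff (R : realType) (f : R -> R) :=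
  forall (d : measure_display) (T : measurableType d) (P Q : probability T R),
    equals_tradeoff f P Q -> equals_tradeoff f Q P.

(* When f is a tradeoff function, exactly one c in [0, 1] satisfies
   f (1 - c) = c; the default value 0 is never reached in that case. *)
Definition fixed_c (R : realType) (f : R -> R) : R :=
  xget 0 [set c : R | 0 <= c <= 1 /\ f (1 - c) = c].

(* Main.v *)
Require Import Defs.
From HB Require Import structures.
From mathcomp Require Import all_boot all_order all_algebra.
From mathcomp Require Import all_classical all_reals all_analysis.
From mathcomp Require Import measurable_realfun.
From mathcomp Require Import ring lra.

(* Testing a half-line gives f (F x) <= F (x - 1) for the cdf F of N, and the
   symmetry of f yields the mirror inequality f (1 - F x) <= 1 - F (x + 1).
   Iterating, the two tails beyond a -+ t / 2 dominate f^k of the central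
   tails u, v; as f^k is nondecreasing and convex, their sum is at least
   2 f^k ((u + v) / 2). For even t, (u + v) / 2 = 1 / 2. For odd t,
   averaging u >= f (1 - v) and v >= f (1 - u) gives f (1 - w) <= w for
   w = (u + v) / 2, hence c_f <= w. *)

Import Order.TTheory GRing.Theory Num.Theory.
Import numFieldNormedType.Exports.
Local Open Scope classical_set_scope.
Local Open Scope ring_scope.

(** * Tests and the real-valued calculus of their expectations *)

Section tests.
Context {R : realType} {d : measure_display} {T : measurableType d}.
Implicit Types (P Q : probability T R) (phi psi : T -> R) (c : R).

Lemma is_test_cst c : 0 <= c <= 1 -> is_test (cst c : T -> R).
Proof. by move=> c01; split => [|x]. Qed.

Lemma is_test_indic (A : set T) : measurable A -> is_test (\1_A : T -> R).
Proof.
move=> mA; split => [|x]; first exact: measurable_indic.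
by rewrite indicE; case: (x \in A); rewrite /= lexx ler01.
Qed.

Lemma is_test_onem phi : is_test phi -> is_test (fun x => 1 - phi x).
Proof.
move=> [mphi phi01]; split => [|x]; first exact: measurable_funB.
by have /andP[] := phi01 x; lra.
Qed.

Lemma is_test_conv phi psi c : 0 <= c <= 1 -> is_test phi -> is_test psi ->
  is_test (fun x => c * phi x + (1 - c) * psi x).
Proof.
move=> c01 [mphi phi01] [mpsi psi01]; split => [|x].
  by apply: measurable_funD; apply: measurable_funM.
by have /andP[? ?] := phi01 x; have /andP[? ?] := psi01 x; nra.
Qed.

Lemma is_test_integrable P phi : is_test phi ->
  P.-integrable setT (EFin \o phi).
Proof.
move=> [mphi phi01]; apply: measurable_bounded_integrable => //.
  by rewrite -ge0_fin_numE ?fin_num_measure.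
exists 1; split => // M M1 x _ /=.
have /andP[p0 p1] := phi01 x.
by rewrite ger0_norm// (le_trans p1)// ltW.
Qed.

(** A bounded test has finite expectation, so the extended-real inequalities on ['E_P] become real
    ones, within reach of [lra] and [nra]. *)
Lemma expectation_test P phi : is_test phi ->
  ('E_P[phi] = (\int[P]_x phi x)%:E)%E.
Proof.
move=> tphi; rewrite unlock /Rintegral fineK//.
by apply: integrable_fin_num => //; exact: is_test_integrable.
Qed.

Lemma Rintegral_test_cst P c : \int[P]_x (cst c x) = c.
Proof. by rewrite Rintegral_cst//= probability_setT mulr1. Qed.

Lemma Rintegral_test_ge0_le1 P phi : is_test phi -> 0 <= \int[P]_x phi x <= 1.
Proof.
move=> tphi; apply/andP; split.
  by apply: Rintegral_ge0 => x _; have /andP[] := tphi.2 x.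
rewrite -[leRHS](Rintegral_test_cst P 1); apply: le_Rintegral => //.
- exact: is_test_integrable.
- by apply: is_test_integrable; apply: is_test_cst; rewrite ler01 lexx.
- by move=> x _; have /andP[] := tphi.2 x.
Qed.

Lemma Rintegral_test_onem P phi : is_test phi ->
  \int[P]_x (1 - phi x) = 1 - \int[P]_x phi x.
Proof.
move=> tphi; rewrite RintegralB//; last exact: is_test_integrable.
  by rewrite (Rintegral_test_cst P 1).
by apply: is_test_integrable; apply: is_test_cst; rewrite ler01 lexx.
Qed.

Lemma Rintegral_test_conv P phi psi c : 0 <= c <= 1 ->
  is_test phi -> is_test psi ->
  \int[P]_x (c * phi x + (1 - c) * psi x) =
  c * \int[P]_x phi x + (1 - c) * \int[P]_x psi x.
Proof.
move=> c01 tphi tpsi; have iphi := is_test_integrable P _ tphi.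
have ipsi := is_test_integrable P _ tpsi.
have iZ r g : 0 <= r <= 1 -> is_test g ->
    P.-integrable setT (EFin \o (fun x => r * g x)).
  move=> r01 tg; apply: is_test_integrable; split => [|x].
    by apply: measurable_funM => //; exact: tg.1.
  by have /andP[? ?] := tg.2 x; nra.
by rewrite RintegralD ?RintegralZl//; apply: iZ => //; lra.
Qed.

Lemma Rintegral_test_indic P A : measurable A ->
  \int[P]_x (\1_A x) = fine (P A).
Proof. by move=> mA; rewrite /Rintegral integral_indic// setIT. Qed.

Lemma tradeoff_le P Q phi (alpha : R) : is_test phi ->
  \int[P]_x phi x <= 1 - alpha ->
  (tradeoff P Q alpha <= (1 - \int[Q]_x phi x)%:E)%E.
Proof.
move=> tphi Pphi; apply: ereal_inf_lbound; exists phi.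
  by split => //; rewrite expectation_test// lee_fin.
by rewrite expectation_test// EFinB.
Qed.

(** The infimum may not be attained, so a test can be extracted only below a strict upper bound;
    callers take [r] slightly above the value of [f]. *)
Lemma tradeoff_lt P Q (alpha r : R) : (tradeoff P Q alpha < r%:E)%E ->
  exists2 phi, is_test phi &
    \int[P]_x phi x <= 1 - alpha /\ 1 - \int[Q]_x phi x < r.
Proof.
move=> /ereal_inf_lt[_ [phi [tphi Pphi] <-]].
rewrite expectation_test// -EFinB lte_fin => Qphi.
by exists phi => //; split => //; rewrite -lee_fin -expectation_test.
Qed.

End tests.

(* First Borel-Cantelli lemma for tests: if the rejection rates [1 - phi n] have
   summable [Q]-expectations, then their sum is [Q]-almost surely finite, while
   off the divergence set they tend to 0. *)
Lemma perfect_test (R : realType) d (T : measurableType d)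
    (P Q : probability T R) (b : R) :
  (forall e, 0 < e -> exists2 phi, is_test phi &
     \int[P]_x phi x <= b /\ 1 - \int[Q]_x phi x < e) ->
  exists2 psi, is_test psi & \int[Q]_x psi x = 0 /\ 1 - \int[P]_x psi x <= b.
Proof.
move=> H.
(* The errors [1 / 2 ^ n.+1] sum to 1, which makes the [Q]-integral of [h] below finite. *)
have /choice[phi phiP] : forall n : nat, exists phi : T -> R, is_test phi /\
    (\int[P]_x phi x <= b /\ 1 - \int[Q]_x phi x < 1 / (2 ^ n.+1)%:R).
  move=> n; have [|phi ? ?] := H (1 / (2 ^ n.+1)%:R); last by exists phi.
  by rewrite divr_gt0// ltr0n expn_gt0.
pose g n x := 1 - phi n x.
have tg n : is_test (g n) by apply: is_test_onem; exact: (phiP n).1.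
have g0 n x : 0 <= g n x by have /andP[] := (tg n).2 x.
have mg n : measurable_fun setT (EFin \o g n).
  by apply/measurable_EFinP; exact: (tg n).1.
pose h x : \bar R := (\sum_(n <oo) (g n x)%:E)%E.
have mh : measurable_fun setT h.
  by apply: ge0_emeasurable_sum => [n x _ _|n _]; [rewrite lee_fin|exact: mg].
have h0 x : (0 <= h x)%E by apply: nneseries_ge0 => n _ _; rewrite lee_fin.
pose D := h @^-1` [set +oo%E].
have mD : measurable D by rewrite -[D]setTI; exact: mh.
have Qh : (\int[Q]_x h x < +oo)%E.
  rewrite integral_nneseries//; last by move=> n x _; rewrite lee_fin.
  apply: (@le_lt_trans _ _ 1%:E); last exact: ltry.
  apply: le_trans (epsilon_trick0 xpredT ler01).
  apply: lee_nneseries => [n _ _|n _].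
    by apply: integral_ge0 => x _; rewrite lee_fin.
  have := expectation_test Q _ (tg n); rewrite unlock => ->.
  rewrite lee_fin Rintegral_test_onem; last exact: (phiP n).1.
  by apply: ltW; exact: (phiP n).2.2.
have QD : Q D = 0%E.
  have ih : Q.-integrable setT h.
    by apply/integrableP; split => //; under eq_integral do rewrite gee0_abs//.
  have /negligibleP : Q.-negligible D.
    apply: negligibleS (integrable_ae measurableT ih).
    by move=> x /= Dx /(_ I); rewrite Dx.
  exact.
(* [D] is [Q]-null, so what remains is [1 - b <= P D]. *)
exists (\1_D); first exact: is_test_indic.
rewrite !Rintegral_test_indic// QD; split => //.
have mDc := measurableC mD.
have cv : (\int[P]_(x in ~` D) (EFin \o g n) x)%E @[n --> \oo] --> 0%E.
  have [//|||||_ _] := @dominated_convergence _ T R P _ mDc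
    (fun n => EFin \o g n) (cst 0%E) (cst 1%E).
  - by move=> n; apply: measurable_funS (mg n).
  - exact: measurable_cst.
  - apply: aeW => x Dx.
    have hx : (h x < +oo)%E by rewrite ltey; apply/eqP.
    apply: cvg_EFin; first by near=> n.
    exact: (cvg_series_cvg_0 (nnseries_is_cvg (fun n => g0 n x) hx)).
  - apply: (integrableS measurableT) => //.
    apply: (is_test_integrable P (cst 1)).
    by apply: is_test_cst; rewrite ler01 lexx.
  - apply: aeW => x n _ /=; rewrite lee_fin ger0_norm//.
    by have /andP[] := (tg n).2 x.
  by rewrite integral0.
(* The [P]-integral of [g n] is at least [1 - b]. Bounding [g n] by 1 on [D] leaves the integral off
   [D], which vanishes in the limit by [cv]. *)
have gb n : ((1 - b)%:E <= P D + \int[P]_(x in ~` D) (EFin \o g n) x)%E.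
  have : ((1 - b)%:E <= \int[P]_x (EFin \o g n) x)%E.
    have := expectation_test P _ (tg n); rewrite unlock => ->.
    rewrite lee_fin Rintegral_test_onem; last exact: (phiP n).1.
    by have := (phiP n).2.1; lra.
  move=> /le_trans; apply.
  rewrite -(setUv D) ge0_integral_setU//=; last 3 first.
  - by rewrite setUv.
  - by move=> x _; rewrite lee_fin.
  - by apply/disj_setPCl.
  apply: leeD2r; rewrite -[leRHS]mul1e -integral_cst//.
  apply: ge0_le_integral => //.
  - by move=> x _; rewrite lee_fin.
  - exact: measurable_funS (mg n).
  - by move=> x _; rewrite lee_fin; have /andP[] := (tg n).2 x.
have PDcv : (P D + \int[P]_(x in ~` D) (EFin \o g n) x)%E @[n --> \oo] -->
    (P D + 0)%E.
  apply: cvgeD; [by rewrite fin_num_adde_defl|exact: cvg_cst|exact: cv].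
have : ((1 - b)%:E <= P D)%E.
  by rewrite -[leRHS]adde0; apply: (cvge_ge _ PDcv); exact: nearW.
rewrite -[P D]fineK ?fin_num_measure// lee_fin; lra.
Unshelve. all: by end_near. Qed.

(** * Order, convexity and symmetry properties of tradeoff functions *)

Section tradeoff_functions.
Context {R : realType} {f : R -> R}.
Context {d : measure_display} {T : measurableType d} {P Q : probability T R}.
Hypothesis fPQ : equals_tradeoff f P Q.

Let tradeoff_fun_le_test phi (alpha : R) : 0 <= alpha <= 1 -> is_test phi ->
  \int[P]_x phi x <= 1 - alpha -> f alpha <= 1 - \int[Q]_x phi x.
Proof. by move=> a01 tphi Pphi; rewrite -lee_fin fPQ//; exact: tradeoff_le. Qed.

Let tradeoff_fun_lt_test (alpha r : R) : 0 <= alpha <= 1 -> f alpha < r ->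
  exists2 phi, is_test phi &
    \int[P]_x phi x <= 1 - alpha /\ 1 - \int[Q]_x phi x < r.
Proof.
by move=> a01 fr; apply: tradeoff_lt; rewrite -fPQ// lte_fin.
Qed.

Lemma tradeoff_fun_ge0 (x : R) : 0 <= x <= 1 -> 0 <= f x.
Proof.
move=> x01; rewrite leNgt; apply/negP.
move=> /(tradeoff_fun_lt_test _ _ x01)[phi tphi [_]].
by have /andP[] := Rintegral_test_ge0_le1 Q _ tphi; lra.
Qed.

Lemma tradeoff_fun_le_id (x : R) : 0 <= x <= 1 -> f x <= x.
Proof.
move=> x01; have t1x : is_test (cst (1 - x) : T -> R) by apply: is_test_cst; lra.
apply: le_trans (tradeoff_fun_le_test _ _ x01 t1x _) _.
  by rewrite Rintegral_test_cst.
by rewrite (Rintegral_test_cst Q (1 - x)); lra.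
Qed.

(** A test admissible at [y] is admissible at [x], where the bound on its [P]-expectation is
    weaker. *)
Lemma tradeoff_fun_homo (x y : R) : 0 <= x -> x <= y -> y <= 1 -> f x <= f y.
Proof.
move=> x0 xy y1; apply/ler_addgt0Pr => e e0.
have y01 : 0 <= y <= 1 by lra.
have [|phi tphi [Pphi Qphi]] := tradeoff_fun_lt_test y (f y + e) y01; first lra.
apply: (le_trans (tradeoff_fun_le_test _ x _ tphi _)); lra.
Qed.

(** Mixing near-optimal tests for [x] and [y] with weights [c] and [1 - c] gives an admissible test
    for the mixed argument. *)
Lemma tradeoff_fun_convex (x y c : R) : 0 <= x <= 1 -> 0 <= y <= 1 ->
  0 <= c <= 1 -> f (c * x + (1 - c) * y) <= c * f x + (1 - c) * f y.
Proof.
move=> x01 y01 c01; apply/ler_addgt0Pr => e e0.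
have [|phi tphi [Pphi Qphi]] := tradeoff_fun_lt_test x (f x + e) x01; first lra.
have [|psi tpsi [Ppsi Qpsi]] := tradeoff_fun_lt_test y (f y + e) y01; first lra.
have tchi := is_test_conv _ _ _ c01 tphi tpsi.
apply: (le_trans (tradeoff_fun_le_test _ _ _ tchi _)).
- nra.
- rewrite Rintegral_test_conv//; nra.
- rewrite Rintegral_test_conv//; nra.
Qed.

(* The complement of a test for [T(P, Q)] is a test for [T(Q, P)]. For [a < 1]
   the infimum need not be attained: its slack is absorbed by the convexity of
   [f]. At [a = 1], where convexity does not prevent a jump, [perfect_test]
   attains it. *)
Lemma tradeoff_fun_swap (a b : R) : equals_tradeoff f Q P ->
  0 <= a <= 1 -> 0 <= b <= 1 -> f (1 - b) <= 1 - a -> f a <= b.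
Proof.
move=> fQP a01 b01 fb.
have b01' : 0 <= 1 - b <= 1 by lra.
have [a1|a1] := eqVneq a 1; last first.
  rewrite leNgt; apply/negP => bfa.
  have a1' : a < 1 by rewrite lt_neqAle a1; case/andP: a01.
  have := tradeoff_fun_le_id _ a01 => faa.
  (* This slack is proportional to [1 - a], so that [a] divides the segment from [a - e] to 1 in a
     ratio depending only on [f a - b]. *)
  pose e := (f a - b) * (1 - a).
  have e0 : 0 < e by rewrite mulr_gt0 ?subr_gt0.
  have ea : e <= a by rewrite /e; nra.
  have [|phi tphi [Pphi Qphi]] := tradeoff_fun_lt_test (1 - b) (1 - a + e) b01'.
    lra.
  have fae : f (a - e) <= b.
    rewrite -lee_fin fQP; last lra.
    apply: le_trans (tradeoff_le _ _ _ _ (is_test_onem _ tphi) _) _.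
      by rewrite Rintegral_test_onem//; lra.
    by rewrite Rintegral_test_onem// lee_fin; lra.
  (* The weight for which [a] is the mixture of [a - e] and 1. Convexity then gives
     [f a <= c * b + (1 - c) = c * f a], absurd since [c < 1] and [f a > b >= 0]. *)
  pose c := 1 / (1 + (f a - b)).
  have c01 : 0 <= c <= 1.
    by rewrite /c divr_ge0//= ?ler_pdivrMr; lra.
  have cE : c * (1 + (f a - b)) = 1 by rewrite /c divfK//; lra.
  have := tradeoff_fun_convex (a - e) 1 c _ _ c01.
  have -> : c * (a - e) + (1 - c) * 1 = a.
    by transitivity (1 - (1 - a) * (c * (1 + (f a - b)))); [rewrite /e|rewrite cE]; ring.
  have f11 : f 1 <= 1 by apply: tradeoff_fun_le_id; lra.
  nra.
have [e e0|psi tpsi [Qpsi Ppsi]] := perfect_test _ _ _ P Q b.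
  have [|phi tphi [Pphi Qphi]] := tradeoff_fun_lt_test (1 - b) e b01'; first lra.
  by exists phi => //; split => //; lra.
rewrite -lee_fin fQP// a1; apply: le_trans (tradeoff_le _ _ _ _ tpsi _) _.
  by rewrite Qpsi subrr.
by rewrite lee_fin.
Qed.

End tradeoff_functions.

(** * Iterates of [f] along unit shifts of a distribution function *)

Section iterates.
Context {R : realType} {f : R -> R}.
Hypothesis f_ge0 : forall x, 0 <= x <= 1 -> 0 <= f x.
Hypothesis f_le_id : forall x, 0 <= x <= 1 -> f x <= x.
Hypothesis f_homo : forall x y, 0 <= x -> x <= y -> y <= 1 -> f x <= f y.
Hypothesis f_midconvex : forall x y, 0 <= x <= 1 -> 0 <= y <= 1 ->
  f ((x + y) / 2) <= (f x + f y) / 2.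

Lemma iter01 k x : 0 <= x <= 1 -> 0 <= iter k f x <= 1.
Proof.
move=> x01; elim: k => //= k IH.
by have := f_ge0 _ IH; have := f_le_id _ IH; lra.
Qed.

Lemma iter_le k x y : 0 <= x -> x <= y -> y <= 1 -> iter k f x <= iter k f y.
Proof.
move=> x0 xy y1; elim: k => //= k IH.
by apply: f_homo => //; [have := iter01 k x|have := iter01 k y]; lra.
Qed.

(** Monotonicity of [f] carries the induction hypothesis through one more application, and midpoint
    convexity then splits the mean. *)
Lemma iter_midconvex k x y : 0 <= x <= 1 -> 0 <= y <= 1 ->
  iter k f ((x + y) / 2) <= (iter k f x + iter k f y) / 2.
Proof.
move=> x01 y01; elim: k => //= k IH.
have := iter01 k _ x01; have := iter01 k _ y01; move=> iy ix.
have im : 0 <= iter k f ((x + y) / 2) <= 1 by apply: iter01; lra.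
apply: le_trans (f_midconvex _ _ ix iy); apply: f_homo => //; lra.
Qed.

Context {F : R -> R}.
Hypothesis F01 : forall x, 0 <= F x <= 1.
Hypothesis F_left : forall x, f (F x) <= F (x - 1).
Hypothesis F_right : forall x, f (1 - F x) <= 1 - F (x + 1).

Lemma iter_cdf_left k x : iter k f (F x) <= F (x - k%:R).
Proof.
elim: k => [|k IH] /=; first by rewrite subr0.
have -> : x - k.+1%:R = (x - k%:R) - 1 by rewrite -addn1 natrD; ring.
apply: le_trans (F_left _); apply: f_homo => //.
  by case/andP: (iter01 k _ (F01 x)).
by case/andP: (F01 (x - k%:R)).
Qed.

Lemma iter_cdf_right k x : iter k f (1 - F x) <= 1 - F (x + k%:R).
Proof.
elim: k => [|k IH] /=; first by rewrite addr0.
have -> : x + k.+1%:R = (x + k%:R) + 1 by rewrite -addn1 natrD; ring.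
have F01' y : 0 <= 1 - F y <= 1 by have := F01 y; lra.
apply: le_trans (F_right _); apply: f_homo => //.
  by case/andP: (iter01 k _ (F01' x)).
by case/andP: (F01' (x + k%:R)).
Qed.

(** The interval from [x] to [y] is widened by [k] on each side. The parameter [z] serves both
    parities: [fixed_c f] when [y = x + 1], and 1/2 when [y = x]. *)
Lemma cdf_itv_iter k x y z : 0 <= z -> z <= (F x + (1 - F y)) / 2 ->
  F (y + k%:R) - F (x - k%:R) <= 1 - 2 * iter k f z.
Proof.
move=> z0 zw; have Fx := F01 x; have Fy := F01 y.
have Fy' : 0 <= 1 - F y <= 1 by lra.
have := iter_midconvex k _ _ Fx Fy'.
have := iter_le k z ((F x + (1 - F y)) / 2).
have := iter_cdf_left k x; have := iter_cdf_right k y; lra.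
Qed.

Lemma fixed_c_ge0 : 0 <= fixed_c f.
Proof. by rewrite /fixed_c; case: xgetP => // c _ [/andP[]]. Qed.

Lemma fixed_c_le x : fixed_c f <= (F x + (1 - F (x + 1))) / 2.
Proof.
set w := (_ + _) / 2; have Fx := F01 x; have Fx1 := F01 (x + 1).
have fw : f (1 - w) <= w.
  have -> : 1 - w = ((1 - F x) + F (x + 1)) / 2 by rewrite /w; field.
  apply: le_trans (f_midconvex _ _ _ _) _; [lra|lra|].
  have := F_right x; have := F_left (x + 1); rewrite addrK /w; lra.
(* The default value 0 of [xget] is at most [w]. For a genuine fixed point, [w < c] would give
   [c = f (1 - c) <= f (1 - w) <= w]. *)
rewrite /fixed_c; case: xgetP => [c _ [c01 fc]|_]; last by rewrite /w; lra.
rewrite leNgt; apply/negP => wc.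
have := f_homo (1 - c) (1 - w); rewrite fc /w in fw wc *; lra.
Qed.

End iterates.

(** * The law of [N] against its unit shift *)

Lemma shift_tradeoff_le (R : realType) (f : R -> R)
    (d : measure_display) (Omega : measurableType d) (P : probability Omega R)
    (N : {RV P >-> R}) (A : set R) (alpha : R) :
  (forall alpha : R, 0 <= alpha <= 1 ->
     ((f alpha)%:E <= tradeoff_rv N (N \+ cst 1)%R alpha)%E) ->
  measurable A -> 0 <= alpha <= 1 -> fine (P (N @^-1` A)) <= 1 - alpha ->
  f alpha <= 1 - fine (P [set w | A (N w + 1)]).
Proof.
move=> N_ge mA a01 PA; rewrite -lee_fin; apply: le_trans (N_ge _ a01) _.
(* The indicator of [A] is the test; its integrals under the two laws are the probabilities that [N]
   and [N + 1] lie in [A]. *)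
apply: le_trans (tradeoff_le _ _ _ _ (is_test_indic _ mA) _) _.
  by rewrite Rintegral_test_indic.
by rewrite Rintegral_test_indic.
Qed.

Theorem theorem5 (R : realType) (f : R -> R)
    (d : measure_display) (Omega : measurableType d) (P : probability Omega R)
    (N : {RV P >-> R})
    (f_tradeoff : tradeoff_function f)
    (f_symmetric : symmetric_tradeoff f)
    (f_nontrivial : nontrivial_tradeoff f)
    (N_ge : forall alpha : R, 0 <= alpha <= 1 ->
       ((f alpha)%:E <= tradeoff_rv N (N \+ cst 1)%R alpha)%E) :
  forall t : nat, (0 < t)%N ->
  let concentration : \bar R :=
    ereal_sup [set P [set w | - (t%:R / 2) < N w - a <= t%:R / 2]
              | a in [set: R]] in
  forall k : nat,
    (t = (2 * k + 1)%N ->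
       (concentration <= (1 - 2 * iter k f (fixed_c f))%:E)%E) /\
    (t = (2 * k)%N ->
       (concentration <= (1 - 2 * iter k f (1 / 2))%:E)%E).
Proof.
move=> t _ concentration k.
have [d0 [T0 [P0 [Q0 fPQ]]]] := f_tradeoff.
have fQP := f_symmetric _ _ _ _ fPQ.
have f_midconvex x y : 0 <= x <= 1 -> 0 <= y <= 1 ->
    f ((x + y) / 2) <= (f x + f y) / 2.
  move=> x01 y01; have := tradeoff_fun_convex fPQ x y (1 / 2) x01 y01.
  have -> : 1 / 2 * x + (1 - 1 / 2) * y = (x + y) / 2 by field.
  lra.
pose F x := fine (P [set w | N w <= x]).
have mle x : measurable [set w | N w <= x].
  by rewrite -[X in measurable X]setTI; exact: measurable_fun_le.
have F01 x : 0 <= F x <= 1.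
  rewrite fine_ge0//= -lee_fin fineK ?fin_num_measure//.
  exact: probability_le1.
have PgtE x : fine (P [set w | x < N w]) = 1 - F x.
  have -> : [set w | x < N w] = ~` [set w | N w <= x].
    by apply/seteqP; split => w /=; rewrite ltNge => /negP.
  by rewrite probability_setC// fineB ?fin_num_measure.
have mgt (x : R) : measurable [set y : R | x < y].
  by rewrite -set_itvoy; exact: measurable_itv.
have F_left x : f (F x) <= F (x - 1).
  have := shift_tradeoff_le _ _ _ _ _ _ _ (F x) N_ge (mgt x) (F01 x).
  have -> : [set w | [set y | x < y] (N w + 1)] = [set w | x - 1 < N w].
    by apply/seteqP; split => w /=; rewrite ltrBlDr.
  by rewrite !PgtE subKr; apply.
have F_right x : f (1 - F x) <= 1 - F (x + 1).
  (* With [a = 1 - F x] and [b = 1 - F (x + 1)], the swapped inequality is [f (F (x + 1)) <= F x],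
     again a half-line test. *)
  apply: (tradeoff_fun_swap fPQ) => //.
  - by have := F01 x; lra.
  - by have := F01 (x + 1); lra.
  have Fx1 : 0 <= 1 - (1 - F (x + 1)) <= 1 by have := F01 (x + 1); lra.
  have := shift_tradeoff_le _ _ _ _ _ _ _ _ N_ge (mgt (x + 1)) Fx1.
  have -> : [set w | [set y | x + 1 < y] (N w + 1)] = [set w | x < N w].
    by apply/seteqP; split => w /=; rewrite ltrD2r.
  by rewrite !PgtE; apply; lra.
have concentration_le (r : R) :
    (forall a, F (a + t%:R / 2) - F (a - t%:R / 2) <= r) ->
    (concentration <= r%:E)%E.
  move=> Fr; apply: ge_ereal_sup => _ [a _ <-].
  (* The half-open window is a difference of closed half-lines, so its probability is an exact
     increment of [F], even with atoms. *)
  have -> : [set w | - (t%:R / 2) < N w - a <= t%:R / 2] =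
      [set w | N w <= a + t%:R / 2] `\` [set w | N w <= a - t%:R / 2].
    apply/seteqP; split => w /=.
      by move=> ?; split; [|apply/negP; rewrite -ltNge]; lra.
    by move=> [? /negP]; rewrite -ltNge; lra.
  rewrite measureD ?ltey_eq ?fin_num_measure// setIidr; last first.
    by move=> w /=; have := ler0n R t; lra.
  apply: le_trans (_ : (F (a + t%:R / 2) - F (a - t%:R / 2))%:E <= _)%E.
    by rewrite EFinB !fineK ?fin_num_measure.
  by rewrite lee_fin.
have bound := cdf_itv_iter (tradeoff_fun_ge0 fPQ) (tradeoff_fun_le_id fPQ)
  (tradeoff_fun_homo fPQ) f_midconvex F01 F_left F_right.
split=> tE; apply: concentration_le => a.
(* Odd [t]: the core is the unit interval centred at [a], and [k] shifts on each side reach total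
   length [2 * k + 1]. *)
- have := bound k (a - 1 / 2) (a - 1 / 2 + 1) (fixed_c f) fixed_c_ge0
    (fixed_c_le (tradeoff_fun_homo fPQ) f_midconvex F01 F_left F_right _).
  suff [-> ->] : a - 1 / 2 + 1 + k%:R = a + t%:R / 2 /\
    a - 1 / 2 - k%:R = a - t%:R / 2 by [].
  by rewrite tE natrD natrM; split; field.
(* Even [t]: the core is empty and its two tails [F a] and [1 - F a] average to 1/2. *)
- have := bound k a a (1 / 2).
  have -> : k%:R = t%:R / 2 :> R by rewrite tE natrM; field.
  by apply; lra.
Qed.
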